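(* Let $A_1,\ldots,A_m\in\mathbb{M}_d$. Then, for all integers $i,j\ge 0$, $$\lambda_{1+i+j}^{\downarrow}\left(\left|\sum_{k=1}^m A_k\right|\right)\le\frac{\lambda_{1+i}^{\downarrow}\left(\sum_{k=1}^m|A_k|_{\mathrm{qsym}}\right)+\lambda_{1+j}^{\downarrow}\left(\sum_{k=1}^m|A_k|_{\mathrm{qsym}}\right)}{\sqrt{2}}.$$
   Context: $d,m\ge 1$ are integers, $\mathbb{M}_d$ is the space of complex $d\times d$ matrices and $\mathbb{M}_d^+$ its cone of positive semidefinite matrices. For $A\in\mathbb{M}_d$, $|A|=(A^*A)^{1/2}$, so $|A^*|=(AA^* )^{1/2}$. The quadratic symmetric modulus of $A$ is $$|A|_{\mathrm{qsym}}:=\sqrt{\frac{|A|^2+|A^*|^2}{2}}\in\mathbb{M}_d^+.$$ For $A\in\mathbb{M}_d^+$, $\lambda_1^{\downarrow}(A)\ge\cdots\ge\lambda_d^{\downarrow}(A)$ are the eigenvalues of $A$ in nonincreasing order, with multiplicity, and by convention $\lambda_j^{\downarrow}(A):=0$ for $j>d$. *)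

(* Defs.v *)
From HB Require Import structures.
From mathcomp Require Import all_boot all_order all_algebra.
From mathcomp Require Import spectral sesquilinear complex reals.

Set Implicit Arguments.
Unset Strict Implicit.
Unset Printing Implicit Defensive.

Import Order.TTheory GRing.Theory Num.Theory.
Local Open Scope ring_scope.
Local Open Scope sesquilinear_scope.

Section Defs.
Variable C : numClosedFieldType.

Definition psdmx n (A : 'M[C]_n) : Prop :=
  A \is hermsymmx /\ forall u : 'rV[C]_n, 0 <= (u *m A *m u^t*) 0 0.

(* Functional calculus; a junk value unless A is positive semidefinite, in
   which case it is the unique positive semidefinite square root of A: see
   sqrtmx_psd, sqrtmxK and sqrtmx_uniq. *)
Definition sqrtmx n (A : 'M[C]_n) : 'M[C]_n :=
  invmx (spectralmx A) *m diag_mx (map_mx sqrtC (spectral_diag A))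
    *m spectralmx A.

Definition modmx n (A : 'M[C]_n) : 'M[C]_n := sqrtmx (A^t* *m A).

Definition qsymmx n (A : 'M[C]_n) : 'M[C]_n :=
  sqrtmx (2^-1 *: (modmx A *m modmx A + modmx (A^t*) *m modmx (A^t*))).

(* The roots of the characteristic polynomial, with multiplicity. The order of
   C is partial, so the sequence is guaranteed to be sorted only when all
   eigenvalues are real, e.g. for Hermitian A: see eigvals_sorted. *)
Definition eigvals n (A : 'M[C]_n) : seq C :=
  sort >=%R (sval (closed_field_poly_normal (char_poly A))).

(* 1-based: lambda_desc A 1 is the largest eigenvalue; 0 beyond the n-th. *)
Definition lambda_desc n (A : 'M[C]_n) (k : nat) : C := nth 0 (eigvals A) k.-1.

Lemma char_poly_eigvals n (A : 'M[C]_n) :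
  char_poly A = \prod_(z <- eigvals A) ('X - z%:P).
Proof.
rewrite /eigvals; case: closed_field_poly_normal => r /= Dr.
rewrite (perm_big r) /=; last by rewrite perm_sort.
by rewrite {1}Dr (monicP (char_poly_monic A)) scale1r.
Qed.

Lemma size_eigvals n (A : 'M[C]_n) : size (eigvals A) = n.
Proof.
have := size_char_poly A.
by rewrite char_poly_eigvals size_prod_XsubC => -[].
Qed.

Lemma mem_eigvals n (A : 'M[C]_n) a : (a \in eigvals A) = eigenvalue A a.
Proof. by rewrite eigenvalue_root_char char_poly_eigvals root_prod_XsubC. Qed.

Lemma hermsymmx_adj n (A : 'M[C]_n) : A \is hermsymmx <-> A^t* = A.
Proof.
split=> [/is_hermitianmxP|AE]; first by rewrite expr0 scale1r.
by apply/is_hermitianmxP; rewrite expr0 scale1r AE.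
Qed.

Lemma adjM m n p (A : 'M[C]_(m, n)) (B : 'M[C]_(n, p)) :
  (A *m B)^t* = B^t* *m A^t*.
Proof. by rewrite trmx_mul map_mxM. Qed.

Lemma form_ge0 n (u : 'rV[C]_n) : 0 <= (u *m u^t*) 0 0.
Proof. by rewrite mxE sumr_ge0 // => i _; rewrite !mxE mul_conjC_ge0. Qed.

Lemma form_eq0 n (u : 'rV[C]_n) : ((u *m u^t*) 0 0 == 0) = (u == 0).
Proof.
apply/idP/eqP => [|->]; last by rewrite mul0mx mxE.
rewrite mxE psumr_eq0 => [/allP u0|i _]; last by rewrite !mxE mul_conjC_ge0.
apply/rowP => i; have := u0 i (mem_index_enum i).
by rewrite !mxE mul_conjC_eq0 => /eqP.
Qed.

Lemma eigvals_real n (A : 'M[C]_n) :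
  A \is hermsymmx -> {in eigvals A, forall a, a \is Num.real}.
Proof.
move=> /hermsymmx_adj AE a; rewrite mem_eigvals => /eigenvalueP[v vA v0].
have E1 : (v *m A *m v^t*) 0 0 = a * (v *m v^t*) 0 0.
  by rewrite vA -scalemxAl mxE.
have E2 : (v *m A *m v^t*) 0 0 = a^* * (v *m v^t*) 0 0.
  have -> : v *m A *m v^t* = v *m (v *m A)^t* by rewrite adjM AE mulmxA.
  by rewrite vA linearZ /= map_mxZ -scalemxAr mxE.
apply/CrealP/(@mulIf _ ((v *m v^t*) 0 0)); first by rewrite form_eq0.
by rewrite -E1 -E2.
Qed.

Lemma eigvals_sorted n (A : 'M[C]_n) :
  A \is hermsymmx -> sorted >=%R (eigvals A).
Proof.
move=> AH; apply: (sort_sorted_in (P := Num.real)).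
  by move=> x y xR yR; rewrite /= orbC real_leVge.
by apply/allP => x xA; apply: (eigvals_real AH); rewrite mem_sort.
Qed.

Lemma psdmx_mul_adj m n (A : 'M[C]_(m, n)) : psdmx (A *m A^t*).
Proof.
split; first by apply/hermsymmx_adj; rewrite adjM trmxCK.
by move=> u; rewrite mulmxA -mulmxA -adjM form_ge0.
Qed.

Lemma psdmxD n (A B : 'M[C]_n) : psdmx A -> psdmx B -> psdmx (A + B).
Proof.
move=> [/hermsymmx_adj AH Ap] [/hermsymmx_adj BH Bp]; split.
  by apply/hermsymmx_adj; rewrite linearD /= map_mxD AH BH.
by move=> u; rewrite mulmxDr mulmxDl mxE addr_ge0.
Qed.

Lemma psdmxZ n a (A : 'M[C]_n) : 0 <= a -> psdmx A -> psdmx (a *: A).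
Proof.
move=> a0 [/hermsymmx_adj AH Ap]; split.
  by apply/hermsymmx_adj; rewrite linearZ /= map_mxZ AH /= geC0_conj.
by move=> u; rewrite -scalemxAr -scalemxAl mxE mulr_ge0.
Qed.

Lemma psdmx_conj m n (B : 'M[C]_(m, n)) (A : 'M[C]_n) :
  psdmx A -> psdmx (B *m A *m B^t*).
Proof.
move=> [/hermsymmx_adj AH Ap]; split.
  by apply/hermsymmx_adj; rewrite !adjM trmxCK AH mulmxA.
by move=> u; have := Ap (u *m B); rewrite adjM !mulmxA.
Qed.

Lemma psdmx_diag n (d : 'rV[C]_n) :
  psdmx (diag_mx d) <-> forall i, 0 <= d 0 i.
Proof.
split=> [[_ dp] i | d0].
  have := dp (delta_mx 0 i).
  rewrite -rowE mxE (bigD1 i) //= big1 => [|j jNi].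
    by rewrite !mxE !eqxx rmorph1 mulr1 addr0.
  by rewrite !mxE eq_sym (negPf jNi) mulr0n mul0r.
rewrite (_ : diag_mx d = diag_mx (map_mx sqrtC d) *m
                         (diag_mx (map_mx sqrtC d))^t*).
  exact: psdmx_mul_adj.
rewrite tr_diag_mx map_diag_mx mulmx_diag; congr diag_mx.
apply/rowP => i; rewrite !mxE /=.
by rewrite [X in _ * X]geC0_conj ?sqrtC_ge0 // -expr2 sqrtCK.
Qed.

Lemma psdmx_spectralE n (A : 'M[C]_n) : psdmx A ->
  A = (spectralmx A)^t* *m diag_mx (spectral_diag A) *m spectralmx A.
Proof.
move=> [AH _]; rewrite -invmx_unitary ?spectral_unitarymx //.
exact/orthomx_spectralP/hermitian_normalmx.
Qed.

Lemma psdmx_spectral_diag_ge0 n (A : 'M[C]_n) :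
  psdmx A -> forall i, 0 <= spectral_diag A 0 i.
Proof.
move=> Apsd; have Pu := spectral_unitarymx A; apply/psdmx_diag.
have := psdmx_conj (spectralmx A) Apsd.
rewrite {2}(psdmx_spectralE Apsd) !mulmxA (unitarymxP Pu) mul1mx.
by rewrite mulmxtVK.
Qed.

Lemma sqrtmx_psd n (A : 'M[C]_n) : psdmx A -> psdmx (sqrtmx A).
Proof.
move=> Apsd; have Pu := spectral_unitarymx A.
rewrite /sqrtmx invmx_unitary // -{2}[spectralmx A]trmxCK.
apply/psdmx_conj/psdmx_diag => i.
by rewrite mxE sqrtC_ge0 psdmx_spectral_diag_ge0.
Qed.

Lemma sqrtmxK n (A : 'M[C]_n) : psdmx A -> sqrtmx A *m sqrtmx A = A.
Proof.
move=> [AH _]; rewrite [RHS](orthomx_spectralP (hermitian_normalmx AH)).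
rewrite /sqrtmx !mulmxA mulmxK ?spectral_unit //; congr (_ *m _).
rewrite -mulmxA mulmx_diag; congr (_ *m diag_mx _).
by apply/rowP => i; rewrite !mxE -expr2 sqrtCK.
Qed.

Lemma sqrtmx_uniq n (A B : 'M[C]_n) :
  psdmx A -> psdmx B -> B *m B = A -> B = sqrtmx A.
Proof.
move=> Apsd Bpsd BBA; have Spsd := sqrtmx_psd Apsd.
have SE := psdmx_spectralE Spsd; have BE := psdmx_spectralE Bpsd.
have /unitarymxP := spectral_unitarymx B.
have /unitarymxP := spectral_unitarymx (sqrtmx A).
have := psdmx_spectral_diag_ge0 Bpsd; have := psdmx_spectral_diag_ge0 Spsd.
have := spectral_unit B; have := spectral_unit (sqrtmx A).
have : sqrtmx A *m sqrtmx A = B *m B by rewrite sqrtmxK.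
move: SE BE; set S := sqrtmx A.
move: (spectralmx S) (spectral_diag S) => Q e.
move: (spectralmx B) (spectral_diag B) => P d.
move=> SE BE SB Qu Pu e0 d0 QQ PP.
pose W := Q *m P^t*.
have QtQ : Q^t* *m Q = 1%:M by apply: mulmx1C.
have PtP : P^t* *m P = 1%:M by apply: mulmx1C.
have QS : Q *m S = diag_mx e *m Q by rewrite {1}SE !mulmxA QQ mul1mx.
have BP : B *m P^t* = P^t* *m diag_mx d by rewrite {1}BE -!mulmxA PP mulmx1.
have W2 : diag_mx e *m (diag_mx e *m W) = W *m diag_mx d *m diag_mx d.
  rewrite /W !mulmxA -(mulmxA _ _ Q) -QS mulmxA -QS -(mulmxA Q) SB.
  by rewrite -!mulmxA BP !mulmxA -(mulmxA _ B) BP !mulmxA.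
have W1 : diag_mx e *m W = W *m diag_mx d.
  move: (W) W2 => X X2.
  apply/matrixP => i j; move/matrixP: X2 => /(_ i j).
  rewrite !mul_diag_mx !mul_mx_diag !mxE.
  have [->|Xn0] := eqVneq (X i j) 0; first by rewrite !(mulr0, mul0r).
  rewrite mulrA -expr2 -mulrA -expr2 mulrC => /(mulfI Xn0) /eqP.
  by rewrite eqrXn2 // => /eqP ->; rewrite mulrC.
have : Q^t* *m (diag_mx e *m W) *m P = Q^t* *m (W *m diag_mx d) *m P.
  by rewrite W1.
rewrite /W !mulmxA QtQ mul1mx -BE => <-.
by rewrite -[_ *m P^t* *m P]mulmxA PtP mulmx1 -SE.
Qed.

Lemma modmx_psd n (A : 'M[C]_n) : psdmx (modmx A).
Proof. by apply: sqrtmx_psd; rewrite -{2}[A]trmxCK; apply: psdmx_mul_adj. Qed.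

Lemma modmxK n (A : 'M[C]_n) : modmx A *m modmx A = A^t* *m A.
Proof. by apply: sqrtmxK; rewrite -{2}[A]trmxCK; apply: psdmx_mul_adj. Qed.

Lemma qsymmx_arg_psd n (A : 'M[C]_n) :
  psdmx (2^-1 *: (modmx A *m modmx A + modmx (A^t*) *m modmx (A^t*))).
Proof.
rewrite !modmxK trmxCK; apply: psdmxZ; first by rewrite invr_ge0 ler0n.
by apply: psdmxD; [rewrite -{2}[A]trmxCK|]; apply: psdmx_mul_adj.
Qed.

Lemma qsymmx_psd n (A : 'M[C]_n) : psdmx (qsymmx A).
Proof. exact/sqrtmx_psd/qsymmx_arg_psd. Qed.

End Defs.

(* Main.v *)
(* Let T be the sum of the A_k and S the sum of the Q_k = |A_k|_qsym. Both |A_k|^2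
   and |A_k^*|^2 are at most 2 Q_k^2, so |A_k| and |A_k^*| are at most
   sqrt 2 Q_k by monotonicity of the square root. As [|A^*|, A; A^*, |A|] is
   positive semidefinite, so is [sqrt 2 S, T; T^*, sqrt 2 S]. Evaluated along a
   contraction W with T = W |T| this gives 2 |T| <= sqrt 2 (W^* S W + S), and a
   dimension count on spans of eigenvectors concludes, as for Weyl's
   inequality. *)

Require Import Defs.
From mathcomp Require Import all_boot all_order all_fingroup all_algebra.
From mathcomp Require Import spectral sesquilinear complex reals.

Import Order.TTheory GRing.Theory Num.Theory.
Local Open Scope ring_scope.
Local Open Scope complex_scope.

Section QuadraticForms.
Set Implicit Arguments.
Unset Strict Implicit.
Local Open Scope sesquilinear_scope.
Variable C : numClosedFieldType.

Local Notation form A x := ((x *m A *m x^t*) 0 0).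
Local Notation sqnorm x := ((x *m x^t*) 0 0).

(** * Adjoints, quadratic forms and monotonicity of the square root *)

Lemma adjD m n (A B : 'M[C]_(m, n)) : (A + B)^t* = A^t* + B^t*.
Proof. by rewrite linearD /= map_mxD. Qed.

Lemma adjB m n (A B : 'M[C]_(m, n)) : (A - B)^t* = A^t* - B^t*.
Proof. by rewrite linearB /= map_mxB. Qed.

Lemma adjZ m n a (A : 'M[C]_(m, n)) : (a *: A)^t* = a^* *: A^t*.
Proof. by rewrite linearZ /= map_mxZ. Qed.

Lemma adj_sum m n (I : finType) (A : I -> 'M[C]_(m, n)) :
  (\sum_k A k)^t* = \sum_k (A k)^t*.
Proof. by rewrite linear_sum /= raddf_sum. Qed.

Lemma psdmx_adj n (A : 'M[C]_n) : psdmx A -> A^t* = A.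
Proof. by case=> /hermsymmx_adj. Qed.

Lemma formB n (A B : 'M[C]_n) (x : 'rV_n) :
  form (A - B) x = form A x - form B x.
Proof. by rewrite mulmxBr mulmxBl mxE [X in _ + X]mxE. Qed.

Lemma form_le n (A B : 'M[C]_n) (x : 'rV_n) :
  psdmx (B - A) -> form A x <= form B x.
Proof. by case=> _ /(_ x); rewrite formB subr_ge0. Qed.

(** The diagonal entries of M^* M are the squared norms of the rows of M^*. *)
Lemma adj_mul_eq0 m n (M : 'M[C]_(m, n)) : M^t* *m M = 0 -> M = 0.
Proof.
move=> MM; suff M0 : M^t* = 0 by rewrite -[M]trmxCK M0 trmx0 map_mx0.
apply/row_matrixP => i; rewrite row0; apply/eqP; rewrite -form_eq0.
have -> : row i (M^t*) *m (row i (M^t*))^t* = row i (M^t* *m M) *m (delta_mx 0 i)^T.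
  by rewrite !rowE adjM trmxCK !mulmxA trmx_delta map_delta_mx.
by rewrite MM row0 mul0mx mxE.
Qed.

(* Otherwise an eigenvector v of N - M for an eigenvalue e < 0 satisfies
   v (N^2 - M^2) v* = e (v N v* + v M v* ) >= 0, which forces
   v N v* = v M v* = 0 and then e = 0. *)
Lemma psdmx_sqr_le n (M N : 'M[C]_n) : psdmx M -> psdmx N ->
  psdmx (N *m N - M *m M) -> psdmx (N - M).
Proof.
move=> Mp Np [_ NM].
have DH : N - M \is hermsymmx.
  by apply/hermsymmx_adj; rewrite adjB !psdmx_adj.
set D := N - M in DH *.
have Vu := spectral_unitarymx D; have VV := unitarymxP Vu.
have DE := orthomx_spectralP (hermitian_normalmx DH).
rewrite DE invmx_unitary // -{2}[spectralmx D]trmxCK.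
apply/psdmx_conj/psdmx_diag => i.
set e := spectral_diag D 0 i; set v := row i (spectralmx D).
have vD : v *m D = e *: v.
  rewrite {1}DE invmx_unitary // /v rowE !mulmxA -(mulmxA _ _ (_^t*)) VV mulmx1.
  rewrite -!rowE row_diag_mx -scalemxAl.
  by rewrite rowE.
have v1 : sqnorm v = 1.
  rewrite /v rowE adjM -mulmxA (mulmxA _ _ (_^t*)) VV mul1mx.
  by rewrite -rowE !mxE !eqxx rmorph1.
have eE : e = form D v by rewrite vD -scalemxAl mxE v1 mulr1.
have bE : form (M *m D) v = e^* * form M v.
  have -> : v *m (M *m D) *m v^t* = v *m M *m (v *m D)^t*.
    by rewrite adjM (hermsymmx_adj D).1 // !mulmxA.
  by rewrite vD adjZ -scalemxAr mxE.
have cE : form (D *m N) v = e * form N v.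
  by rewrite mulmxA vD -!scalemxAl mxE.
(* The order of [C] is partial, so only for a real [e] does refuting e < 0 give 0 <= e. *)
have eR : e \is Num.real.
  rewrite eE /D formB rpredB // ger0_real //.
    by case: Np.
  by case: Mp.
(* N^2 - M^2 = D N + M D holds without commutation and puts [D] next to [v] on the left and next to
   v^* on the right. *)
have e2 : 0 <= e * (form N v + form M v).
  have := NM v; have -> : N *m N - M *m M = D *m N + M *m D.
    by rewrite /D mulmxBl mulmxBr addrA subrK.
  by rewrite mulmxDr mulmxDl mxE cE bE (CrealP eR) mulrDr.
have b0 : 0 <= form M v by case: Mp.
have c0 : 0 <= form N v by case: Np.
rewrite real_leNgt ?real0 //; apply/negP => e0.
move: e2; rewrite nmulr_rge0 // => s0.
have : form D v = 0.
  have /eqP := le_anti (introT andP (conj s0 (addr_ge0 c0 b0))).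
  by rewrite paddr_eq0 // formB => /andP[/eqP-> /eqP->]; rewrite subr0.
by move=> D0; rewrite eE D0 ltxx in e0.
Qed.

(** * Moduli and block inequalities *)

Lemma qsymmx_adj n (A : 'M[C]_n) : qsymmx (A^t*) = qsymmx A.
Proof. by rewrite /qsymmx trmxCK addrC. Qed.

(** With Q = |A|_qsym, 2 Q^2 - |A|^2 = A A^* is positive semidefinite, and the square root is
    monotone. *)
Lemma modmx_le_qsymmx n (A : 'M[C]_n) :
  psdmx (sqrtC 2 *: qsymmx A - modmx A).
Proof.
have s2 : 0 <= sqrtC 2 :> C by rewrite sqrtC_ge0 ler0n.
apply: psdmx_sqr_le; first exact: modmx_psd.
  exact/psdmxZ/qsymmx_psd.
rewrite -scalemxAl -scalemxAr scalerA -expr2 sqrtCK sqrtmxK; last first.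
  exact: qsymmx_arg_psd.
rewrite scalerA mulfV ?pnatr_eq0 // scale1r addrC addKr modmxK trmxCK.
exact: psdmx_mul_adj.
Qed.

(* W = T |T|^+ with the pseudo-inverse of |T|, obtained by inverting the
   spectrum: the convention 0^-1 = 0 is what is needed on the kernel. *)
Lemma polar_contraction n (T : 'M[C]_n) : exists W : 'M[C]_n,
  [/\ psdmx (1%:M - W^t* *m W), W^t* *m T = modmx T & W *m modmx T = T].
Proof.
have Pp := modmx_psd T; have PT := modmxK T.
have Vu := spectral_unitarymx (modmx T); have VV := unitarymxP Vu.
have PE := psdmx_spectralE Pp.
have e0 := psdmx_spectral_diag_ge0 Pp.
move: (modmx T) (spectralmx _) (spectral_diag _) Pp PT Vu VV PE e0.
move=> P V e Pp PT Vu VV PE e0.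
have VtV : V^t* *m V = 1%:M by apply: mulmx1C.
have mulV (a b : 'rV[C]_n) : (V^t* *m diag_mx a *m V) *m (V^t* *m diag_mx b *m V)
    = V^t* *m diag_mx (\row_i (a 0 i * b 0 i)) *m V.
  by rewrite !mulmxA -(mulmxA _ V) VV mulmx1 -(mulmxA (V^t*)) mulmx_diag.
pose f : 'rV[C]_n := \row_i (e 0 i)^-1.
pose Q := V^t* *m diag_mx f *m V.
have Qp : psdmx Q.
  rewrite /Q -{2}[V]trmxCK; apply/psdmx_conj/psdmx_diag => i.
  by rewrite mxE invr_ge0.
have QPP : Q *m (P *m P) = P.
  rewrite {1 2}PE /Q !mulV PE; congr (_ *m diag_mx _ *m _).
  apply/rowP => i; rewrite !mxE.
  by have [->|en] := eqVneq (e 0 i) 0; rewrite ?mulr0 // mulKf.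
have PQP : P *m (Q *m P) = P.
  rewrite {1 2}PE /Q !mulV PE; congr (_ *m diag_mx _ *m _).
  apply/rowP => i; rewrite !mxE.
  by have [->|en] := eqVneq (e 0 i) 0; rewrite ?mul0r // mulVf // mulr1.
exists (T *m Q); rewrite adjM psdmx_adj //; split.
(* Here W^* W = P Q, so 1 - W^* W is diagonal in the eigenbasis of [P], with entry 1 where [e]
   vanishes and 0 elsewhere. *)
- rewrite mulmxA -(mulmxA Q) -PT QPP {1}PE /Q mulV -{1}VtV.
  rewrite -{1}[V^t*]mulmx1 -mulmxBl -mulmxBr -{2}[V]trmxCK.
  rewrite -diag_const_mx -linearB /=.
  apply/psdmx_conj/psdmx_diag => i; rewrite !mxE.
  by have [->|en] := eqVneq (e 0 i) 0; rewrite ?mul0r ?subr0 // mulfV // subrr.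
- by rewrite -mulmxA -PT.
(* T (1 - Q P) vanishes because its Gram matrix has the right factor P (P - P Q P) = 0. *)
move: (Q) PQP => Q' PQP; apply/eqP.
rewrite -subr_eq0 -{2}[T]mulmx1 -mulmxA -mulmxBr; apply/eqP.
apply: adj_mul_eq0.
rewrite adjM !mulmxA -(mulmxA _ (T^t*)) -PT -!mulmxA mulmxBr mulmx1 PQP.
by rewrite subrr !mulmx0.
Qed.

(* With A = W|A| one has |A*| = W|A|W*, and the difference of the two sides is
   (xW - y)|A|(xW - y)*. *)
Lemma modmx_block_ge0 n (A : 'M[C]_n) (x y : 'rV_n) :
  (x *m A *m y^t*) 0 0 + (y *m A^t* *m x^t*) 0 0
    <= form (modmx (A^t*)) x + form (modmx A) y.
Proof.
have [W [_ WA WP]] := polar_contraction A.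
have Pp := modmx_psd A.
have PW : modmx A *m W^t* = A^t* by rewrite -[in RHS]WP adjM (psdmx_adj Pp).
(* W |A| W^* is positive semidefinite with square A W^* A W^* = A |A| W^* = A A^*. *)
have -> : modmx (A^t*) = W *m modmx A *m W^t*.
  rewrite {1}/modmx trmxCK; apply/esym/sqrtmx_uniq.
  - exact: psdmx_mul_adj.
  - exact: psdmx_conj.
  move: (modmx A) WA WP PW {Pp} => P WA WP PW.
  by rewrite WP !mulmxA -(mulmxA A) WA -mulmxA PW.
move: (modmx A) WA WP PW Pp => P WA WP PW [_ /(_ (x *m W - y))].
rewrite mulmxBl adjB adjM mulmxBr !mulmxBl !mulmxA.
rewrite -(mulmxA x W P) WP -(mulmxA y P (W^t*)) PW.
have mx11B (M N : 'M[C]_1) : (M - N) 0 0 = M 0 0 - N 0 0 by rewrite !mxE.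
by rewrite !mx11B opprB addrACA -opprD [X in _ - X]addrC subr_ge0.
Qed.

Lemma formZ n a (A : 'M[C]_n) (x : 'rV_n) : form (a *: A) x = a * form A x.
Proof. by rewrite -scalemxAr -scalemxAl mxE. Qed.

(** [qsymmx] takes the same value at A and A^*, so it dominates both moduli of the block
    inequality. *)
Lemma qsymmx_block_ge0 n (A : 'M[C]_n) (x y : 'rV_n) :
  (x *m A *m y^t*) 0 0 + (y *m A^t* *m x^t*) 0 0
    <= sqrtC 2 * (form (qsymmx A) x + form (qsymmx A) y).
Proof.
apply: le_trans (modmx_block_ge0 A x y) _.
rewrite mulrDr -!formZ -{1}qsymmx_adj.
by apply: lerD; apply: form_le; exact: modmx_le_qsymmx.
Qed.

Lemma psdmx0 n : psdmx (0 : 'M[C]_n).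
Proof. by have := psdmx_mul_adj (0 : 'M[C]_n); rewrite mul0mx. Qed.

Lemma psdmx_sum n (I : finType) (A : I -> 'M[C]_n) :
  (forall k, psdmx (A k)) -> psdmx (\sum_k A k).
Proof.
by move=> Ap; apply: (big_ind (@psdmx C n)) => //; [exact: psdmx0|exact: psdmxD].
Qed.

(** With T the sum, |T| = W^* T = T^* W. The two copies of x |T| x^* are thus the two cross terms at
    the pair (x W^*, x), which are linear in T and can be bounded summand by summand. *)
Lemma modmx_sum_le n (I : finType) (A : I -> 'M[C]_n)
    (S := \sum_k qsymmx (A k)) :
  exists2 W : 'M[C]_n, psdmx (1%:M - W^t* *m W) & forall x : 'rV_n,
    form (modmx (\sum_k A k)) x * 2
      <= sqrtC 2 * (form S (x *m W^t*) + form S x).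
Proof.
have [W [W1 WT _]] := polar_contraction (\sum_k A k).
exists W => // x.
have formT : form (modmx (\sum_k A k)) x
    = (x *m W^t* *m (\sum_k A k) *m x^t*) 0 0 by rewrite -(mulmxA x (W^t*)) WT.
have formTt : form (modmx (\sum_k A k)) x
    = (x *m (\sum_k A k)^t* *m (x *m W^t*)^t*) 0 0.
  rewrite adjM trmxCK -(psdmx_adj (modmx_psd (\sum_k A k))) -WT adjM trmxCK.
  by rewrite !mulmxA.
rewrite mulr_natr mulr2n {1}formT formTt.
rewrite adj_sum /S !mulmx_sumr !mulmx_suml !summxE -!big_split /= mulr_sumr.
by apply: ler_sum => k _; exact: qsymmx_block_ge0.
Qed.

(** * Sorted spectra and variational bounds *)

(** The characteristic polynomial matches [spectral_diag] with the sorted [eigvals] up to a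
    permutation, which is then applied to the rows of the eigenvector matrix. *)
Lemma hermsymmx_eigvalsE n (A : 'M[C]_n) : A \is hermsymmx ->
  exists2 V : 'M[C]_n, V \is unitarymx &
    A = V^t* *m diag_mx (\row_k (eigvals A)`_k) *m V.
Proof.
move=> AH; have Vu := spectral_unitarymx A; have VV := unitarymxP Vu.
have AE := orthomx_spectralP (hermitian_normalmx AH).
rewrite invmx_unitary // in AE.
move: (spectralmx A) (spectral_diag A) Vu VV AE => V e Vu VV AE.
have VtV : V^t* *m V = 1%:M by apply: mulmx1C.
have eE : perm_eq (eigvals A) [tuple e 0 k | k < n].
  apply: prod_XsubC_eq; rewrite -char_poly_eigvals.
  have -> : char_poly A = char_poly (diag_mx e).
    rewrite /char_poly.
    have -> : char_poly_mx A
        = map_mx polyC (V^t* ) *m char_poly_mx (diag_mx e) *m map_mx polyC V.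
      rewrite /char_poly_mx mulmxBr mulmxBl -!map_mxM -AE; congr (_ - _).
      by rewrite mul_mx_scalar -scalemxAl -map_mxM VtV map_mx1 scalemx1.
    by rewrite !det_mulmx mulrC mulrA -det_mulmx -map_mxM VV map_mx1 det1 mul1r.
  rewrite char_poly_trig ?diag_mx_is_trig // big_map /= big_enum /=.
  by apply: eq_bigr => k _; rewrite mxE eqxx.
have /tuple_permP[p sE] := eE.
have sk (k : 'I_n) : (eigvals A)`_k = e 0 (p k).
  by rewrite sE -tnth_nth !tnth_mktuple.
exists (row_perm p V).
  apply/unitarymxP/matrixP => k l.
  move/matrixP: VV => /(_ (p k) (p l)).
  rewrite !mxE (inj_eq perm_inj) => <-.
  by apply: eq_bigr => h _; rewrite !mxE.
rewrite {1}AE; apply/matrixP => k l.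
rewrite !mul_mx_diag !mxE [RHS](reindex_inj (@perm_inj _ p^-1)).
by apply: eq_bigr => h _; rewrite !mxE sk permKV.
Qed.

(* The vectors x whose coordinates on the first k eigenvectors vanish form a
   subspace of codimension k, those whose coordinates beyond the (k+1)-st
   vanish a subspace of dimension k + 1. *)
Lemma lambda_desc_form n (A : 'M[C]_n) : A \is hermsymmx ->
  exists V : 'M[C]_n, forall (k : 'I_n) (x : 'rV_n),
    ((forall l : 'I_n, (l < k)%N -> (x *m V) 0 l = 0) ->
      form A x <= lambda_desc A k.+1 * sqnorm x) /\
    ((forall l : 'I_n, (k < l)%N -> (x *m V) 0 l = 0) ->
      lambda_desc A k.+1 * sqnorm x <= form A x).
Proof.
move=> AH; have [V Vu AE] := hermsymmx_eigvalsE AH.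
have VtV : V^t* *m V = 1%:M by apply/mulmx1C/unitarymxP.
exists (V^t*) => k x; set c := x *m V^t*.
have cE : c^t* = V *m x^t* by rewrite adjM trmxCK.
have formE : form A x = \sum_(l < n) (eigvals A)`_l * (c 0 l * (c 0 l)^* ).
  rewrite [in LHS]AE !mulmxA -/c -mulmxA -cE mxE.
  by apply: eq_bigr => l _; rewrite mul_mx_diag !mxE mulrAC mulrC.
have sqE : lambda_desc A k.+1 * sqnorm x
    = \sum_(l < n) (eigvals A)`_k * (c 0 l * (c 0 l)^* ).
  have -> : sqnorm x = sqnorm c.
    by rewrite cE mulmxA -(mulmxA x) VtV mulmx1.
  rewrite mxE mulr_sumr.
  by apply: eq_bigr => l _; rewrite !mxE.
have desc (l h : 'I_n) : (l <= h)%N -> (eigvals A)`_h <= (eigvals A)`_l.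
  move=> lh; apply: (sorted_leq_nth (leT := >=%R)) => //.
  - by move=> a b d ba ab; apply: le_trans ab ba.
  - exact: lexx.
  - exact: eigvals_sorted.
  - by rewrite inE size_eigvals.
  - by rewrite inE size_eigvals.
rewrite formE sqE; split=> c0; apply: ler_sum => l _.
  have [lk|kl] := ltnP l k; first by rewrite [c 0 l]c0 // mul0r !mulr0.
  by rewrite ler_wpM2r ?mul_conjC_ge0 ?desc.
have [lk|kl] := leqP l k; last by rewrite [c 0 l]c0 // mul0r !mulr0.
by rewrite ler_wpM2r ?mul_conjC_ge0 ?desc.
Qed.

Lemma lambda_desc_ge0 n (A : 'M[C]_n) k : psdmx A -> 0 <= lambda_desc A k.
Proof.
move=> [_ Ap]; rewrite /lambda_desc.
have [kn|nk] := ltnP k.-1 (size (eigvals A)); last by rewrite nth_default.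
have := mem_nth 0 kn; rewrite mem_eigvals => /eigenvalueP[v vA v0].
have := Ap v; rewrite vA -scalemxAl mxE pmulr_lge0 //.
by rewrite lt_neqAle form_ge0 eq_sym form_eq0 v0.
Qed.

(** * Dimension count *)

Lemma colsub_eq0 m n p (g : 'I_p -> 'I_n) (A : 'M[C]_(m, n)) k l :
  colsub g A = 0 -> A k (g l) = 0.
Proof. by move/matrixP/(_ k l); rewrite !mxE. Qed.

Lemma ex_ker_row n p (M : 'M[C]_(n, p)) : (p < n)%N ->
  exists2 x : 'rV_n, x != 0 & x *m M = 0.
Proof.
move=> pn; have : kermx M != 0.
  by rewrite kermx_eq0 /row_free neq_ltn (leq_ltn_trans (rank_leq_col M)).
by case/rowV0Pn => x /sub_kermxP xM x0; exists x.
Qed.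

Lemma lambda_desc_modmx_sum_le n (I : finType) (A : I -> 'M[C]_n)
    (S := \sum_k qsymmx (A k)) i j :
  lambda_desc (modmx (\sum_k A k)) (1 + i + j)
    <= (lambda_desc S (1 + i) + lambda_desc S (1 + j)) / sqrtC 2.
Proof.
have Sp : psdmx S by apply: psdmx_sum => k; exact: qsymmx_psd.
have s2 : 0 < sqrtC 2 :> C by rewrite sqrtC_gt0 ltr0n.
(* If n <= i + j, the left side is the default value 0. *)
have [nij|ijn] := leqP n (i + j).
  rewrite {1}/lambda_desc nth_default ?size_eigvals //.
  by rewrite divr_ge0 ?addr_ge0 ?lambda_desc_ge0 ?ltW.
have [W W1 TS] := modmx_sum_le A; rewrite -/S in TS.
set T := modmx _ in TS *.
have [V VT] := lambda_desc_form (modmx_psd (\sum_k A k)).1; rewrite -/T in VT.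
have [U US] := lambda_desc_form Sp.1.
have lin : (i < n)%N := leq_ltn_trans (leq_addr j i) ijn.
have ljn : (j < n)%N := leq_ltn_trans (leq_addl i j) ijn.
have tailP (l : 'I_(n - (1 + i + j))) : (1 + i + j + l < n)%N.
  by rewrite -ltn_subRL.
(* The columns encode i conditions on x W^*, j on x for S, and n - (1 + i + j) on x for T: n - 1 in
   all, so a nonzero x satisfies them. *)
pose M := row_mx (row_mx (W^t* *m colsub (widen_ord (ltnW lin)) U)
    (colsub (widen_ord (ltnW ljn)) U)) (colsub (fun l => Ordinal (tailP l)) V).
have [|x x0] := ex_ker_row M.
  by rewrite -ltn_subRL ltn_sub2l // ?add1n.
move=> /eqP; rewrite !mul_mx_row !row_mx_eq0 mulmxA !mulmx_colsub.
case/andP=> /andP[/eqP xWU /eqP xU] /eqP xV.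
have T1 : lambda_desc T (1 + i + j) * sqnorm x <= form T x.
  apply: (VT (Ordinal ijn) x).2 => l ijl.
  have lt : (l - (1 + i + j) < n - (1 + i + j))%N.
    by rewrite ltn_sub2r // (leq_ltn_trans ijl).
  rewrite (_ : l = Ordinal (tailP (Ordinal lt))) ?(colsub_eq0 _ _ xV) //.
  by apply: val_inj; rewrite /= subnKC.
have S1 : form S (x *m W^t*) <= lambda_desc S (1 + i) * sqnorm (x *m W^t*).
  apply: (US (Ordinal lin) _).1 => h hi.
  rewrite (_ : h = widen_ord (ltnW lin) (Ordinal hi)) ?(colsub_eq0 _ _ xWU) //.
  exact: val_inj.
have S2 : form S x <= lambda_desc S (1 + j) * sqnorm x.
  apply: (US (Ordinal ljn) _).1 => h hj.
  rewrite (_ : h = widen_ord (ltnW ljn) (Ordinal hj)) ?(colsub_eq0 _ _ xU) //.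
  exact: val_inj.
have Wx : sqnorm (x *m W^t*) <= sqnorm x.
  by have := form_le x W1; rewrite mulmx1 adjM trmxCK !mulmxA.
have x_gt0 : 0 < sqnorm x by rewrite lt_neqAle form_ge0 eq_sym form_eq0 x0.
(* Multiplying by sqrt 2 twice produces the factor 2 of [TS]. *)
rewrite ler_pdivlMr // -(ler_pM2r s2) -mulrA -expr2 sqrtCK -(ler_pM2r x_gt0).
rewrite mulrAC; apply: le_trans (ler_wpM2r _ T1) _; first exact: ler0n.
apply: le_trans (TS x) _; rewrite [leRHS]mulrAC [leRHS]mulrC ler_pM2l // mulrDl.
(* The norm of x W^* may be replaced by that of x since the eigenvalue of S is nonnegative. *)
apply: lerD S2; apply: le_trans S1 _.
by rewrite ler_wpM2l ?lambda_desc_ge0.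
Qed.

End QuadraticForms.

Theorem corollary2p4 (R : realType) (d m : nat) (hd : (1 <= d)%N) (hm : (1 <= m)%N)
    (A : 'I_m -> 'M[R[i]]_d) (i j : nat) :
  lambda_desc (modmx (\sum_(k < m) A k)) (1 + i + j) <=
    (lambda_desc (\sum_(k < m) qsymmx (A k)) (1 + i) +
     lambda_desc (\sum_(k < m) qsymmx (A k)) (1 + j)) / sqrtC 2.
Proof. exact: lambda_desc_modmx_sum_le. Qed.
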